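(* Let $k$ be a commutative Noetherian ring, and suppose that $\mathcal{C}$ has a generic shift functor $S$. Then every finitely generated $\mathcal{C}$-module is Noetherian if and only if $S M(s)$ is finitely presented for every $s \geqslant 0$.
   Context: Let $k$ be a commutative ring with identity. $\mathcal{C}$ denotes a category whose objects are the nonnegative integers, which is $k$-linear (enriched over $k$-modules), locally finite (each $\mathcal{C}(r,s)$ is a finitely generated $k$-module) and directed ($\mathcal{C}(r,s)=0$ whenever $r>s$). A $\mathcal{C}$-module $V$ is a covariant $k$-linear functor from $\mathcal{C}$ to $k$-modules; write $V_s=V(s)$. It is finitely generated if it contains a finite set of elements (of the various $V_s$) contained in no proper submodule. For $s\geqslant 0$, $M(s)=\mathcal{C}(s,-)$ is the representable (projective) $\mathcal{C}$-module. $V$ is generated in degrees $\leqslant s$ if the only submodule of $V$ containing $V_r$ for all $r\leqslant s$ is $V$; $V$ is generated in degrees $\leqslant -1$ if $V=0$. A $\mathcal{C}$-module is finitely presented if it has a projective resolution $\cdots\to P^2\to P^1\to P^0\to V\to 0$ with $P^0$ and $P^1$ finitely generated. A $\mathcal{C}$-module is Noetherian if all its submodules are finitely generated. A self-embedding functor of degree 1 is a faithful ($k$-linear) functor $\iota:\mathcal{C}\to\mathcal{C}$ with $\iota(s)=s+1$ for all $s\geqslant 0$. A shift functor is the pull-back functor $S=\iota^*$ on the category of all $\mathcal{C}$-modules, $SV=V\circ\iota$ (so $(SV)_s=V_{s+1}$), for such an $\iota$. A shift functor $S$ is generic if there is a natural transformation $\mu:\mathrm{Id}\to S$ such that for every $s\geqslant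 0$ the map $\mu_{M(s)}:M(s)\to SM(s)$ is injective and its cokernel is generated in degrees $\leqslant s-1$. *)

(* Defs.v *)
From HB Require Import structures.
From mathcomp Require Import all_boot all_algebra.
From mathcomp Require Import boolp classical_sets.

Set Implicit Arguments.
Unset Strict Implicit.
Unset Printing Implicit Defensive.
Import GRing.Theory.
Local Open Scope ring_scope.
Local Open Scope classical_set_scope.
Local Open Scope quotient_scope.

Section LinearSubsets.
Variables (k : comPzRingType) (M : lmodType k).

Definition is_ksubmodule (N : set M) : Prop :=
  N 0 /\ forall (a : k) u v, N u -> N v -> N (a *: u + v).

Definition fg_ksubmodule (N : set M) : Prop :=
  exists gs : seq M,
    (forall g, g \in gs -> N g) /\
    (forall x, N x ->
       exists c : 'I_(size gs) -> k, x = \sum_(i < size gs) c i *: gs`_i).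

Definition fg_kmodule : Prop := fg_ksubmodule [set: M].

(* The quotient of M by a submodule, obtained from the quotient of Z-modules
   of ring_quotient by adding the scalar action. *)
Section Quotient.
Variables (N : set M) (subN : is_ksubmodule N).

Definition ksub_pred (_ : is_ksubmodule N) : {pred M} := fun x => `[< N x >].

Lemma ksub_predP x : reflect (N x) (x \in ksub_pred subN).
Proof. exact: asboolP. Qed.

Lemma ksub_pred_closed : submod_closed (ksub_pred subN).
Proof.
by split=> [|a u v /ksub_predP Nu /ksub_predP Nv]; apply/ksub_predP;
   [exact: subN.1 | exact: subN.2].
Qed.

HB.instance Definition _ :=
  GRing.isSubmodClosed.Build k M (ksub_pred subN) ksub_pred_closed.

Definition kquot := Quotient.quot (ksub_pred subN).
HB.instance Definition _ := GRing.Zmodule.on kquot.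
HB.instance Definition _ := EqQuotient.on kquot.

Definition kquot_pi (x : M) : kquot := \pi_kquot x.

Lemma kquot_piP x y : (kquot_pi x = kquot_pi y) <-> N (x - y).
Proof.
split=> [/eqP h|h].
  by apply/ksub_predP; rewrite Quotient.idealrBE.
by apply/eqP; rewrite /kquot_pi -Quotient.idealrBE; apply/ksub_predP.
Qed.

Lemma kquot_piK (x : kquot) : kquot_pi (repr x) = x.
Proof. exact: reprK. Qed.

Lemma kquot_pi_zmod : zmod_morphism kquot_pi.
Proof. by move=> x y; rewrite /kquot_pi raddfB. Qed.

Definition kquot_scale (a : k) (x : kquot) : kquot := kquot_pi (a *: repr x).

Lemma kquot_scaleE a x : kquot_scale a (kquot_pi x) = kquot_pi (a *: x).
Proof.
apply/kquot_piP; rewrite -scalerBr -[a *: _]addr0.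
by apply: subN.2 subN.1; apply/kquot_piP; rewrite kquot_piK.
Qed.

Lemma kquot_piD x y : kquot_pi (x + y) = kquot_pi x + kquot_pi y.
Proof. by rewrite /kquot_pi raddfD. Qed.

Lemma kquot_scaleA a b x :
  kquot_scale a (kquot_scale b x) = kquot_scale (a * b) x.
Proof. by rewrite -[x]kquot_piK !kquot_scaleE scalerA. Qed.

Lemma kquot_scale1 : left_id 1 kquot_scale.
Proof. by move=> x; rewrite -[x]kquot_piK kquot_scaleE scale1r. Qed.

Lemma kquot_scaleDr : right_distributive kquot_scale +%R.
Proof.
move=> a x y; rewrite -[x]kquot_piK -[y]kquot_piK -kquot_piD !kquot_scaleE.
by rewrite scalerDr kquot_piD.
Qed.

Lemma kquot_scaleDl x : {morph kquot_scale^~ x : a b / a + b}.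
Proof.
by move=> a b /=; rewrite -[x]kquot_piK !kquot_scaleE scalerDl kquot_piD.
Qed.

HB.instance Definition _ := GRing.Zmodule_isLmodule.Build k kquot
  kquot_scaleA kquot_scale1 kquot_scaleDr kquot_scaleDl.

Lemma kquot_pi_linear : linear kquot_pi.
Proof. by move=> a x y; rewrite kquot_piD -kquot_scaleE. Qed.

HB.instance Definition _ := GRing.isLinear.Build k M kquot _ kquot_pi
  kquot_pi_linear.

End Quotient.
End LinearSubsets.

Definition noetherian_ring (k : comPzRingType) : Prop :=
  forall I : set k^o, is_ksubmodule I -> fg_ksubmodule I.

(* k-linear categories whose set of objects is nat. *)
Record kcat (k : comPzRingType) := KCat {
  chom :> nat -> nat -> lmodType k;
  cidm : forall s, chom s s;
  ccomp : forall r s t, chom s t -> {linear chom r s -> chom r t};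
  ccomp_linearl : forall r s t (a : k) (g g' : chom s t) (f : chom r s),
    ccomp r (a *: g + g') f = a *: ccomp r g f + ccomp r g' f;
  ccompA : forall q r s t (h : chom s t) (g : chom r s) (f : chom q r),
    ccomp q h (ccomp q g f) = ccomp q (ccomp r h g) f;
  ccomp1l : forall r s (f : chom r s), ccomp r (cidm s) f = f;
  ccomp1r : forall r s (f : chom r s), ccomp r f (cidm r) = f }.

Arguments cidm {_} _ _.
Arguments ccomp {_ _ _ _ _}.

Definition locally_finite (k : comPzRingType) (C : kcat k) : Prop :=
  forall r s, fg_kmodule (C r s).

Definition directed (k : comPzRingType) (C : kcat k) : Prop :=
  forall r s, (s < r)%N -> forall f : C r s, f = 0.

Record cmod (k : comPzRingType) (C : kcat k) := CMod {
  cobj :> nat -> lmodType k;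
  cact : forall r s, C r s -> {linear cobj r -> cobj s};
  cact_linear : forall r s (a : k) (f g : C r s) (v : cobj r),
    cact (a *: f + g) v = a *: cact f v + cact g v;
  cact_id : forall s (v : cobj s), cact (cidm C s) v = v;
  cact_comp : forall r s t (g : C s t) (f : C r s) (v : cobj r),
    cact (ccomp g f) v = cact g (cact f v) }.

Arguments cact {_ _} _ {_ _}.

Record cmod_hom (k : comPzRingType) (C : kcat k) (V W : cmod C) := CModHom {
  cmor :> forall s, {linear V s -> W s};
  cmor_nat : forall r s (f : C r s) (v : V r),
    cmor s (cact V f v) = cact W f (cmor r v) }.

Record submodule (k : comPzRingType) (C : kcat k) (V : cmod C) := Submodule {
  subm :> forall s, set (V s);
  subm_ksub : forall s, is_ksubmodule (@subm s);
  subm_act : forall r s (f : C r s) (v : V r), subm v -> subm (cact V f v) }.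

Section Modules.
Variables (k : comPzRingType) (C : kcat k).
Implicit Types V W P : cmod C.

Definition full_submodule V : submodule V.
Proof. by exists (fun s => [set: V s]) => // s; split. Defined.

Definition fg_submodule V (N : submodule V) : Prop :=
  exists gs : seq {s : nat & V s},
    (forall g, g \in gs -> N (tag g) (tagged g)) /\
    (forall N' : submodule V,
       (forall s, N' s `<=` N s) ->
       (forall g, g \in gs -> N' (tag g) (tagged g)) ->
       forall s, N s `<=` N' s).

Definition finitely_generated V : Prop := fg_submodule (full_submodule V).

Definition noetherian V : Prop := forall N : submodule V, fg_submodule N.

(* d is an integer so that d = -1 is allowed; gen_in_degreesN1 below shows that
   the definition then means V = 0. *)
Definition gen_in_degrees (d : int) V : Prop :=
  forall N : submodule V,
    (forall r : nat, r%:Z <= d -> forall v : V r, N r v) ->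
    forall s (v : V s), N s v.

Definition zero_submodule V : submodule V.
Proof.
exists (fun s => [set 0]) => [s|r s f v /= ->]; last exact: linear0.
by split=> // a u v /= -> ->; rewrite scaler0 addr0.
Defined.

Lemma gen_in_degreesN1 V :
  gen_in_degrees (- 1) V <-> forall s (v : V s), v = 0.
Proof.
split=> [h|V0 N _ s v]; first exact: (h (zero_submodule V)).
by rewrite (V0 s v); exact: (subm_ksub N s).1.
Qed.

(* The representable module M(s) = C(s, -). *)
Definition representable (s : nat) : cmod C :=
  @CMod k C (C s) (fun r t f => ccomp f)
    (fun r t a f g v => ccomp_linearl a f g v)
    (fun t v => ccomp1l v)
    (fun p r t g f v => esym (ccompA g f v)).

Section QuotientModule.
Variables (V : cmod C) (N : submodule V).

Definition mquot_obj (s : nat) : lmodType k := kquot (subm_ksub N s).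

Definition mquot_act_fun r s (f : C r s) (x : mquot_obj r) : mquot_obj s :=
  kquot_pi (subm_ksub N s) (cact V f (repr x)).

Lemma mquot_act_funE r s (f : C r s) (v : V r) :
  mquot_act_fun f (kquot_pi (subm_ksub N r) v) =
  kquot_pi (subm_ksub N s) (cact V f v).
Proof.
apply/kquot_piP; rewrite -linearB; apply: subm_act.
by apply/(kquot_piP (subm_ksub N r)); rewrite kquot_piK.
Qed.

Lemma mquot_act_linear r s (f : C r s) : linear (mquot_act_fun f).
Proof.
move=> a x y; rewrite -[x]kquot_piK -[y]kquot_piK -linearP !mquot_act_funE.
by rewrite !linearP.
Qed.

HB.instance Definition _ r s (f : C r s) :=
  GRing.isLinear.Build k (mquot_obj r) (mquot_obj s) _ (mquot_act_fun f)
    (mquot_act_linear f).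

Definition mquot : cmod C.
Proof.
exists mquot_obj (fun r s f => mquot_act_fun f : {linear _ -> _}).
- move=> r s a f g x /=; rewrite -[x]kquot_piK !mquot_act_funE.
  by rewrite cact_linear linearP.
- by move=> s x /=; rewrite -[x]kquot_piK mquot_act_funE cact_id.
- move=> r s t g f x /=; rewrite -[x]kquot_piK !mquot_act_funE.
  by rewrite cact_comp.
Defined.

End QuotientModule.

Definition image_submodule V W (f : cmod_hom V W) : submodule W.
Proof.
exists (fun s => range (f s)).
- move=> s; split; first by exists 0; rewrite ?linear0.
  by move=> a _ _ [u _ <-] [v _ <-]; exists (a *: u + v); rewrite ?linearP.
- by move=> r s g _ [v _ <-]; exists (cact V g v); rewrite ?cmor_nat.
Defined.

Definition coker V W (f : cmod_hom V W) : cmod C := mquot (image_submodule f).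

Definition hom_surjective V W (f : cmod_hom V W) : Prop :=
  forall s (w : W s), exists v, f s v = w.

Definition hom_injective V W (f : cmod_hom V W) : Prop :=
  forall s, injective (f s).

Definition exact_at U V W (f : cmod_hom U V) (g : cmod_hom V W) : Prop :=
  forall s (v : V s), g s v = 0 <-> exists u, f s u = v.

Definition projective P : Prop :=
  forall V W (e : cmod_hom V W) (f : cmod_hom P W), hom_surjective e ->
    exists g : cmod_hom P V, forall s (x : P s), e s (g s x) = f s x.

Definition projective_resolution V (P : nat -> cmod C)
    (d : forall n, cmod_hom (P n.+1) (P n)) (e : cmod_hom (P 0%N) V) : Prop :=
  [/\ forall n, projective (P n),
      hom_surjective e,
      exact_at (d 0%N) e
    & forall n, exact_at (d n.+1) (d n)].

Definition finitely_presented V : Prop :=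
  exists (P : nat -> cmod C) (d : forall n, cmod_hom (P n.+1) (P n))
         (e : cmod_hom (P 0%N) V),
    [/\ projective_resolution d e,
        finitely_generated (P 0%N)
      & finitely_generated (P 1%N)].

End Modules.

(* Self-embedding functors of degree 1; the object map s |-> s.+1 is built in. *)
Record self_embedding (k : comPzRingType) (C : kcat k) := SelfEmbedding {
  emb :> forall r s, {linear C r s -> C r.+1 s.+1};
  emb_id : forall s, emb s s (cidm C s) = cidm C s.+1;
  emb_comp : forall r s t (g : C s t) (f : C r s),
    emb r t (ccomp g f) = ccomp (emb s t g) (emb r s f);
  emb_faithful : forall r s, injective (emb r s) }.

Section Shift.
Variables (k : comPzRingType) (C : kcat k) (iota : self_embedding C).

Definition shift (V : cmod C) : cmod C.
Proof.
exists (fun s => V s.+1) (fun r s f => cact V (iota r s f)).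
- by move=> r s a f g v; rewrite linearP cact_linear.
- by move=> s v; rewrite emb_id cact_id.
- by move=> r s t g f v; rewrite emb_comp cact_comp.
Defined.

Definition shift_hom (V W : cmod C) (f : cmod_hom V W) :
  cmod_hom (shift V) (shift W) :=
  @CModHom k C (shift V) (shift W) (fun s => f s.+1)
    (fun r s g v => cmor_nat f (iota r s g) v).

Definition natural_to_shift (mu : forall V : cmod C, cmod_hom V (shift V)) :
    Prop :=
  forall (V W : cmod C) (f : cmod_hom V W) s (v : V s),
    shift_hom f s (mu V s v) = mu W s (f s v).

Definition generic_shift : Prop :=
  exists mu : forall V : cmod C, cmod_hom V (shift V),
    natural_to_shift mu /\
    forall s : nat,
      hom_injective (mu (representable C s)) /\
      gen_in_degrees (s%:Z - 1) (coker (mu (representable C s))).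

End Shift.

(* Main.v *)
From HB Require Import structures.
Require Import Defs.
From mathcomp Require Import all_boot all_algebra.
From mathcomp Require Import boolp classical_sets.

(** Both sides of the equivalence come from one fact: each representable module
    M(s) is Noetherian ([noetherian_representable]).  A finitely generated
    module is a quotient of a finite sum of representables
    ([free_cover]), hence Noetherian; and over a category whose finitely
    generated modules are Noetherian, kernels of maps between free modules of
    finite rank can be covered by such modules again, so that every finitely
    generated module, SM(s) for instance, has a resolution by them
    ([finitely_presented_of_noetherian]).

    M(s) is Noetherian by strong induction on s.  Let V = M(s), with
    mu : V -> SV, and let D be the cokernel of mu.  It is generated by finitely
    many elements of degree less than s, so it is Noetherian by the induction
    hypothesis ([noetherian_coker_representable]).  For a submodule X of V let
    X' be the preimage of SX under mu.  By naturality mu is given by the action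
    of morphisms of the category, so X is contained in X', and there is an
    ascending chain X, X', X'', and so on.  Three remarks make X finitely
    generated.

    - If X = X', then X is finitely generated ([fg_saturated]).  Indeed SX
      modulo mu X embeds in D; an element of X of degree n+1 lies in degree n of
      SX, so up to elements generated by finitely many fixed ones it is mu u
      with u in V of degree n, and u is in X' = X.  Induct on n.
    - The union of the chain is such a submodule; being finitely generated, it
      equals some member of the chain ([fg_desat_iter]).
    - If X' is finitely generated, so is X.  Indeed SX is an extension of a
      submodule of D by mu X' ([fg_shift_desat]), and generators of SX
      together with the finitely generated k-module X_0 generate X
      ([fg_unshift]).  Hence finite generation descends the chain to X. *)

Set Implicit Arguments.
Unset Strict Implicit.
Unset Printing Implicit Defensive.
Import GRing.Theory Num.Theory.
Local Open Scope ring_scope.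

(** * Submodules of modules over the base ring *)

Section LinearAlgebra.
Variables (k : comPzRingType) (M : lmodType k).
Implicit Types (N : set M) (gs : seq M).

Lemma ksub_add N u v : is_ksubmodule N -> N u -> N v -> N (u + v).
Proof. by move=> subN Nu Nv; rewrite -[u]scale1r; apply: subN.2. Qed.

Lemma ksub_scale N a u : is_ksubmodule N -> N u -> N (a *: u).
Proof. by move=> subN Nu; rewrite -[_ *: _]addr0; apply: subN.2 subN.1. Qed.

Lemma ksub_sub N u v : is_ksubmodule N -> N u -> N v -> N (u - v).
Proof. by move=> subN Nu Nv; rewrite addrC -scaleN1r; apply: subN.2. Qed.

Lemma ksub_sum N n (F : 'I_n -> M) :
  is_ksubmodule N -> (forall i, N (F i)) -> N (\sum_(i < n) F i).
Proof.
move=> subN NF; elim/big_ind: _ => // [|x y]; first exact: subN.1.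
exact: ksub_add.
Qed.

Definition kspan gs (x : M) : Prop :=
  forall N, is_ksubmodule N -> (forall g, g \in gs -> N g) -> N x.

Lemma kspan_ksub gs : is_ksubmodule (kspan gs).
Proof.
split=> [N subN _|a u v su sv N subN Ngs]; first exact: subN.1.
by apply: subN.2; [apply: su | apply: sv].
Qed.

Lemma kspan_mem gs g : g \in gs -> kspan gs g.
Proof. by move=> ggs N _; apply. Qed.

Lemma kspan_min gs N x :
  is_ksubmodule N -> (forall g, g \in gs -> N g) -> kspan gs x -> N x.
Proof. by move=> subN Ngs; apply. Qed.

Lemma kspan_cons g gs x :
  kspan (g :: gs) x -> exists c y, kspan gs y /\ x = c *: g + y.
Proof.
pose N : set M := fun x => exists c y, kspan gs y /\ x = c *: g + y.
apply: (@kspan_min (g :: gs) N) => [|h]; last first.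
  rewrite inE => /orP[/eqP->|hgs]; first exists 1, 0; last exists 0, h.
    by split; [exact: (kspan_ksub gs).1 | rewrite scale1r addr0].
  by split; [exact: kspan_mem | rewrite scale0r add0r].
split=> [|a _ _ [c [y [sy ->]]] [c' [y' [sy' ->]]]].
  by exists 0, 0; split; [exact: (kspan_ksub gs).1 | rewrite scale0r add0r].
exists (a * c + c'), (a *: y + y'); split; first exact: (kspan_ksub gs).2.
by rewrite scalerDr scalerA scalerDl addrACA.
Qed.

Lemma fg_ksubmodule_kspan N :
  fg_ksubmodule N ->
  exists gs, (forall g, g \in gs -> N g) /\ (forall x, N x -> kspan gs x).
Proof.
case=> gs [Ngs comb]; exists gs; split=> // x /comb[c ->].
move=> N' subN' N'gs; apply: ksub_sum => // i.
by apply: ksub_scale => //; apply/N'gs/mem_nth.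
Qed.

End LinearAlgebra.

Lemma kspan_map (k : comPzRingType) (M M' : lmodType k) (f : {linear M -> M'})
    (gs : seq M) x : kspan gs x -> kspan (map f gs) (f x).
Proof.
apply: (@kspan_min _ _ gs (fun x => kspan (map f gs) (f x))) => [|g ggs].
  split=> [|a u v su sv]; first by rewrite linear0; exact: (kspan_ksub _).1.
  by rewrite linearP; exact: (kspan_ksub _).2.
by apply: kspan_mem; exact: map_f.
Qed.

(** By induction on the number of generators of the ambient span.  The
    coefficients along the first generator [g] of the elements of [N] form an
    ideal; finitely many elements of [N] realise generators of that ideal, and
    they allow every element of [N] to be corrected into the part of [N] lying
    in the span of the remaining generators. *)
Lemma noetherian_ring_ksub (k : comPzRingType) (M : lmodType k)
    (gs : seq M) (N : set M) :
  noetherian_ring k -> is_ksubmodule N -> (forall x, N x -> kspan gs x) ->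
  exists hs : seq M,
    (forall h, h \in hs -> N h) /\ (forall x, N x -> kspan hs x).
Proof.
move=> noeth; elim: gs N => [|g gs IH] N subN Ngs.
  by exists [::].
pose N' : set M := fun x => N x /\ kspan gs x.
have [hs [N'hs spanhs]] : exists hs : seq M,
    (forall h, h \in hs -> N' h) /\ (forall x, N' x -> kspan hs x).
  apply: IH => [|x []//]; split=> [|a u v [Nu su] [Nv sv]].
    by split; [exact: subN.1 | exact: (kspan_ksub gs).1].
  by split; [exact: subN.2 | exact: (kspan_ksub gs).2].
pose I : set k^o := fun a => exists2 y, kspan gs y & N (a *: g + y).
have subI : is_ksubmodule I.
  split=> [|a u v [y sy Ny] [z sz Nz]].
    by exists 0; [exact: (kspan_ksub gs).1
                 | rewrite scale0r addr0; exact: subN.1].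
  exists (a *: y + z); first exact: (kspan_ksub gs).2.
  have -> : (a *: u + v) *: g + (a *: y + z) =
            a *: ((u : k) *: g + y) + ((v : k) *: g + z).
    by rewrite scalerDr scalerA scalerDl addrACA.
  exact: subN.2.
have [as_ [Ias spanas]] := fg_ksubmodule_kspan (noeth I subI).
have [ns [Nns nsP]] : exists ns : seq M, (forall n, n \in ns -> N n) /\
    forall a, a \in as_ -> exists2 y, kspan gs y & a *: g + y \in ns.
  elim: as_ Ias {spanas} => [|a s IHs] Is; first by exists [::].
  have [ns [Nns nsP]] := IHs (fun b bs => Is b (@mem_behead _ (a :: s) b bs)).
  have [y sy Ny] := Is a (mem_head a s).
  exists (a *: g + y :: ns); split=> [n|b]; rewrite inE => /predU1P[->|]//.
  - exact: Nns.
  - by exists y; rewrite ?mem_head.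
  by case/nsP=> z sz zns; exists z; rewrite // inE zns orbT.
exists (ns ++ hs); split=> [h|x Nx].
  by rewrite mem_cat => /orP[/Nns|/N'hs[]].
have [c [y [sy xE]]] := kspan_cons (Ngs x Nx).
have Ic : I c by exists y; rewrite -?xE.
(* an element of the span of [ns] whose coefficient along [g] is that of [x] *)
have [z [sz [w sw wE]]] :
    exists z, kspan ns z /\ exists2 w, kspan gs w & z = c *: g + w.
  pose J : set k^o := fun a =>
    exists z, kspan ns z /\ exists2 w, kspan gs w & z = a *: g + w.
  apply: (kspan_min (N := J)) (spanas c Ic) => [|a /nsP[w sw wns]]; last first.
    by exists (a *: g + w); split; [exact: kspan_mem | exists w].
  split=> [|a u v [z1 [sz1 [w1 sw1 z1E]]] [z2 [sz2 [w2 sw2 z2E]]]].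
    exists 0; split; first exact: (kspan_ksub ns).1.
    by exists 0; [exact: (kspan_ksub gs).1 | rewrite scale0r addr0].
  exists (a *: z1 + z2); split; first exact: (kspan_ksub ns).2.
  exists (a *: w1 + w2); first exact: (kspan_ksub gs).2.
  by rewrite z1E z2E scalerDr scalerA addrACA -scalerDl.
have Nz : N z by apply: kspan_min sz.
have : N' (x - z).
  split; first exact: ksub_sub.
  rewrite xE wE [c *: g + y]addrC addrKA.
  exact: (ksub_sub (kspan_ksub gs)).
move/spanhs=> shs; rewrite -[x](subrK z); apply: (ksub_add (kspan_ksub _)).
  by apply: kspan_min shs => [|h hhs];
     [exact: kspan_ksub | apply: kspan_mem; rewrite mem_cat hhs orbT].
by apply: kspan_min sz => [|h hhs];
   [exact: kspan_ksub | apply: kspan_mem; rewrite mem_cat hhs].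
Qed.

(** * Homomorphisms and submodules *)

Definition linmap (k : comPzRingType) (U V : lmodType k) (f : U -> V)
    (lin_f : linear f) : {linear U -> V} :=
  HB.pack f (GRing.isLinear.Build k U V _ f lin_f).

Section Submodules.
Variables (k : comPzRingType) (C : kcat k).
Implicit Types U V W : cmod C.

Definition elt V s (v : V s) : {s : nat & V s} := existT _ s v.

Definition eqsub V (N N' : submodule V) : Prop :=
  forall s (v : V s), N s v <-> N' s v.

Definition cap_sub V (N N' : submodule V) : submodule V.
Proof.
exists (fun s v => N s v /\ N' s v) => [s|r s f v [Nv N'v]].
  split=> [|a u v [Nu N'u] [Nv N'v]]; split.
  - exact: (subm_ksub N s).1.
  - exact: (subm_ksub N' s).1.
  - exact: (subm_ksub N s).2.
  - exact: (subm_ksub N' s).2.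
by split; apply: subm_act.
Defined.

Definition preim_sub V W (f : cmod_hom V W) (N : submodule W) : submodule V.
Proof.
exists (fun s v => N s (f s v)) => [s|r s g v Nv].
  split=> [|a u v Nu Nv]; first by rewrite linear0; exact: (subm_ksub N s).1.
  by rewrite linearP; exact: (subm_ksub N s).2.
by rewrite cmor_nat; apply: subm_act.
Defined.

Definition img_sub V W (f : cmod_hom V W) (N : submodule V) : submodule W.
Proof.
exists (fun s w => exists2 v, N s v & f s v = w) => [s|r s g _ [v Nv <-]].
  split=> [|a _ _ [u Nu <-] [v Nv <-]].
    by exists 0; [exact: (subm_ksub N s).1 | exact: linear0].
  by exists (a *: u + v); [exact: (subm_ksub N s).2 | exact: linearP].
by exists (cact V g v); [exact: subm_act | exact: cmor_nat].
Defined.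

Definition ker_sub V W (f : cmod_hom V W) : submodule V :=
  preim_sub f (zero_submodule W).

(** Testing against all submodules, not only those inside [N], loses nothing
    because a submodule may be intersected with [N]; see [fg_submoduleP]. *)
Definition generates V (N : submodule V) (gs : seq {s & V s}) : Prop :=
  (forall g, g \in gs -> N (tag g) (tagged g)) /\
  (forall N' : submodule V, (forall g, g \in gs -> N' (tag g) (tagged g)) ->
     forall s (v : V s), N s v -> N' s v).

Lemma fg_submoduleP V (N : submodule V) :
  fg_submodule N <-> exists gs, generates N gs.
Proof.
split=> -[gs [Ngs genN]]; exists gs; split=> //; last first.
  by move=> N' _ N'gs s v; apply: genN.
move=> N' N'gs s v Nv.
suff [] : cap_sub N' N s v by [].
apply: genN Nv => [t u []//|g ggs].
by split; [exact: N'gs | exact: Ngs].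
Qed.

Lemma eqsub_fg V (N N' : submodule V) :
  eqsub N N' -> fg_submodule N -> fg_submodule N'.
Proof.
move=> eqN /fg_submoduleP[gs [Ngs genN]]; apply/fg_submoduleP; exists gs.
split=> [g ggs|N'' N''gs s v]; first exact/eqN/Ngs.
by move/eqN; apply: genN.
Qed.

Lemma fg_img V W (f : cmod_hom V W) (N : submodule V) :
  fg_submodule N -> fg_submodule (img_sub f N).
Proof.
case/fg_submoduleP=> gs [Ngs genN]; apply/fg_submoduleP.
exists [seq elt (f (tag g) (tagged g)) | g <- gs].
split=> [_ /mapP[g ggs ->]|N' N'gs s _ [v Nv <-]] /=.
  by exists (tagged g) => //; exact: Ngs.
apply: (genN (preim_sub f N')) Nv => g ggs /=.
exact: (N'gs _ (map_f _ ggs)).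
Qed.

(** The [hs] lift generators of [f N], and [f (N' :&: N)] contains the latter.
    Working with lifts keeps the correction [y] of [x] inside the source of [f],
    where the difference [x - y] can be treated further. *)
Lemma fg_img_lift V W (f : cmod_hom V W) (N : submodule V) :
  fg_submodule (img_sub f N) ->
  exists hs : seq {s & V s}, (forall h, h \in hs -> N (tag h) (tagged h)) /\
    forall N' : submodule V, (forall h, h \in hs -> N' (tag h) (tagged h)) ->
      forall s (x : V s), N s x -> exists y, [/\ N s y, N' s y & f s x = f s y].
Proof.
case/fg_submoduleP=> gs [Ngs genN].
have [hs [Nhs hsP]] : exists hs : seq {s & V s},
    (forall h, h \in hs -> N (tag h) (tagged h)) /\
    (forall g, g \in gs -> exists2 v, f (tag g) v = tagged g &
       elt v \in hs).
  elim: gs Ngs {genN} => [|[s w] gs IH] Ngs; first by exists [::].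
  have [hs [Nhs hsP]] := IH (fun g => Ngs g \o @mem_behead _ (elt w :: gs) g).
  have [/= v Nv fv] := Ngs _ (mem_head _ _).
  exists (elt v :: hs); split=> [h|g]; rewrite inE => /predU1P[->|]//.
  - exact: Nhs.
  - by exists v; rewrite // mem_head.
  by case/hsP=> u fu uhs; exists u; rewrite // inE uhs orbT.
exists hs; split=> // N' N'hs s x Nx.
have [||y [N'y Ny] fy] := genN (img_sub f (cap_sub N' N)) _ s (f s x).
- move=> g /hsP[v fv vhs]; exists v => //.
  by split; [exact: (N'hs _ vhs) | exact: (Nhs _ vhs)].
- by exists x.
by exists y.
Qed.

Lemma fg_extension V W (f : cmod_hom V W) (N : submodule V) :
  fg_submodule (img_sub f N) -> fg_submodule (cap_sub N (ker_sub f)) ->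
  fg_submodule N.
Proof.
case/fg_img_lift=> hs [Nhs hsP] /fg_submoduleP[gs [Kgs genK]].
apply/fg_submoduleP; exists (hs ++ gs); split=> [g|N' N'gs s x Nx].
  by rewrite mem_cat => /orP[/Nhs|/Kgs[]].
have N'hs h : h \in hs -> N' (tag h) (tagged h).
  by move=> hhs; apply: N'gs; rewrite mem_cat hhs.
have [y [Ny N'y fxy]] := hsP N' N'hs s x Nx.
rewrite -[x](subrK y); apply: (ksub_add (subm_ksub N' s)) => //.
apply: genK => [g ggs|]; first by apply: N'gs; rewrite mem_cat ggs orbT.
split; first exact: (ksub_sub (subm_ksub N s)).
by rewrite /= linearB fxy subrr.
Qed.

Lemma noetherian_quotient V W (f : cmod_hom V W) :
  hom_surjective f -> noetherian V -> noetherian W.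
Proof.
move=> f_surj noethV N; apply: eqsub_fg (fg_img f (noethV (preim_sub f N))).
move=> s w; split=> [[v Nv <-]//|Nw].
by have [v fv] := f_surj s w; exists v; rewrite //= fv.
Qed.

(** * Free modules *)

Definition mk_hom V W (f : forall s, V s -> W s)
    (lin_f : forall s, linear (f s))
    (nat_f : forall r s (g : C r s) v, f s (cact V g v) = cact W g (f r v)) :
  cmod_hom V W := @CModHom k C V W (fun s => linmap (lin_f s)) nat_f.

Definition mk_mod (obj : nat -> lmodType k)
    (act : forall r s, C r s -> obj r -> obj s)
    (lin_act : forall r s (f : C r s), linear (act r s f))
    (act_linear : forall r s (a : k) (f g : C r s) v,
       act r s (a *: f + g) v = a *: act r s f v + act r s g v)
    (act_id : forall s v, act s s (cidm C s) v = v)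
    (act_comp : forall r s t (g : C s t) (f : C r s) v,
       act r t (ccomp g f) v = act s t g (act r s f v)) : cmod C :=
  @CMod k C obj (fun r s f => linmap (lin_act r s f)) act_linear act_id act_comp.

Definition zero_hom V W : cmod_hom V W.
Proof.
refine (@mk_hom V W (fun _ _ => 0) _ _).
- by move=> s a u v /=; rewrite scaler0 addr0.
- by move=> r s f v /=; rewrite linear0.
Defined.

Definition hom_comp U V W (g : cmod_hom V W) (f : cmod_hom U V) : cmod_hom U W.
Proof.
refine (@mk_hom U W (fun s u => g s (f s u)) _ _).
- by move=> s a u v /=; rewrite !linearP.
- by move=> r s h u /=; rewrite !cmor_nat.
Defined.

Definition zero_mod : cmod C.
Proof.
refine (@mk_mod (fun=> 'rV[k]_0) (fun _ _ _ _ => 0) _ _ _ _).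
- by move=> r s f a u v /=; rewrite scaler0 addr0.
- by move=> r s a f g v /=; rewrite scaler0 addr0.
- by move=> s v; rewrite [LHS]thinmx0 [RHS]thinmx0.
- by [].
Defined.

Definition dsum U V : cmod C.
Proof.
refine (@mk_mod (fun s => (U s * V s)%type)
  (fun r s f x => (cact U f x.1, cact V f x.2)) _ _ _ _).
- by move=> r s f a u v; congr (_, _); rewrite /= linearP.
- by move=> r s a f g v; congr (_, _); rewrite /= cact_linear.
- by move=> s [u v] /=; rewrite !cact_id.
- by move=> r s t g f v /=; rewrite !cact_comp.
Defined.

Definition dsum_inl U V : cmod_hom U (dsum U V).
Proof.
refine (@mk_hom U (dsum U V) (fun s u => (u, 0)) _ _).
- by move=> s a u v; congr (_, _); rewrite /= scaler0 addr0.
- by move=> r s f v /=; rewrite linear0.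
Defined.

Definition dsum_inr U V : cmod_hom V (dsum U V).
Proof.
refine (@mk_hom V (dsum U V) (fun s v => (0, v)) _ _).
- by move=> s a u v; congr (_, _); rewrite /= scaler0 addr0.
- by move=> r s f v /=; rewrite linear0.
Defined.

Definition dsum_snd U V : cmod_hom (dsum U V) V.
Proof.
by refine (@mk_hom (dsum U V) V (fun=> snd) _ _).
Defined.

Definition dsum_elim U V W (f : cmod_hom U W) (g : cmod_hom V W) :
  cmod_hom (dsum U V) W.
Proof.
refine (@mk_hom (dsum U V) W (fun s x => f s x.1 + g s x.2) _ _).
- by move=> s a u v /=; rewrite !linearP scalerDr addrACA.
- by move=> r s h v /=; rewrite !cmor_nat linearD.
Defined.

Definition yoneda V s (v : V s) : cmod_hom (representable C s) V.
Proof.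
refine (@mk_hom (representable C s) V (fun t (f : C s t) => cact V f v) _ _).
- by move=> t a f g; exact: cact_linear.
- by move=> r t f v' /=; exact: cact_comp.
Defined.

Lemma cact0 V r s (v : V r) : cact V (0 : C r s) v = 0.
Proof. exact: (linear0 (yoneda v s)). Qed.

Fixpoint free (ds : seq nat) : cmod C :=
  if ds is d :: ds' then dsum (representable C d) (free ds') else zero_mod.

Lemma fg_dsum_sub U V (N : submodule (dsum U V)) :
  fg_submodule (preim_sub (dsum_inl U V) N) ->
  fg_submodule (img_sub (dsum_snd U V) N) -> fg_submodule N.
Proof.
move=> fgU fgV; apply: (fg_extension fgV).
apply: eqsub_fg (fg_img (dsum_inl U V) fgU) => s [u v].
by split=> [[x Nx [<- <-]]//|[Nuv /= v0]]; exists u; rewrite /= -?v0.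
Qed.

Lemma fg_representable s : finitely_generated (representable C s).
Proof.
apply/fg_submoduleP; exists [:: @elt (representable C s) s (cidm C s)].
split=> // N Ngs t f _.
have := subm_act (s := t) f (Ngs _ (mem_head _ _)).
by rewrite /= ccomp1r.
Qed.

Lemma fg_zero_mod (N : submodule zero_mod) : fg_submodule N.
Proof.
apply/fg_submoduleP; exists [::]; split=> // N' _ s v _.
by rewrite (_ : v = 0); [exact: (subm_ksub N' s).1 | exact: thinmx0].
Qed.

Lemma fg_free ds : finitely_generated (free ds).
Proof.
elim: ds => [|d ds IH]; first exact: fg_zero_mod.
apply: fg_dsum_sub; first exact: eqsub_fg (fg_representable d).
apply: eqsub_fg IH => s v; split=> // _.
by exists (0, v).
Qed.

Lemma noetherian_free ds :
  (forall d, d \in ds -> noetherian (representable C d)) -> noetherian (free ds).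
Proof.
elim: ds => [|d ds IH] noeth N; first exact: fg_zero_mod.
apply: fg_dsum_sub; first exact: (noeth d (mem_head d ds)).
by apply: IH => d' d'ds; apply: noeth; rewrite inE d'ds orbT.
Qed.

Lemma projective_free ds : projective (free ds).
Proof.
elim: ds => [|d ds IH] V W e f e_surj.
  exists (zero_hom _ _) => s x /=.
  by rewrite (_ : x = 0) ?linear0 //; exact: thinmx0.
have [v ev] := e_surj d (f d (cidm C d, 0)).
have [g gP] := IH V W e (hom_comp f (dsum_inr _ _)) e_surj.
exists (dsum_elim (yoneda v) g) => s [h x] /=.
rewrite linearD gP cmor_nat ev -cmor_nat /= -linearD /= linear0 ccomp1r.
by congr (f s _); congr (_, _); rewrite /= ?addr0 ?add0r.
Qed.

(** Each generator [g] receives its own summand [M(tag g)], mapped by [yoneda];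
    the image lies in [N] and contains the generators. *)
Lemma free_cover V (N : submodule V) (gs : seq {s & V s}) :
  generates N gs ->
  exists e : cmod_hom (free (map tag gs)) V,
    forall s (v : V s), N s v <-> exists x, e s x = v.
Proof.
move=> [Ngs genN].
have [e [Ne egs]] : exists e : cmod_hom (free (map tag gs)) V,
    (forall s x, N s (e s x)) /\
    (forall g, g \in gs -> exists x, e (tag g) x = tagged g).
  elim: gs Ngs {genN} => [|[d v] gs IH] Ngs.
    by exists (zero_hom _ _); split=> // s x; exact: (subm_ksub N s).1.
  have [e [Ne egs]] := IH (fun g => Ngs g \o @mem_behead _ (elt v :: gs) g).
  exists (dsum_elim (yoneda v) e); split=> [s [h x] /=|g].
    apply: (ksub_add (subm_ksub N s)) => //.
    exact: (subm_act h (Ngs _ (mem_head _ _))).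
  rewrite inE => /predU1P[->|/egs[x ex]].
    by exists (cidm C d, 0); rewrite /= cact_id linear0 addr0.
  by exists (0, x); rewrite /= cact0 add0r.
exists e => s v; split=> [Nv|[x <-]//].
have [|x _ ex] := genN (image_submodule e) _ s v Nv; last by exists x.
by move=> g /egs[x ex]; exists x.
Qed.

Lemma noetherian_of_generators V (gs : seq {s & V s}) :
  generates (full_submodule V) gs ->
  (forall g, g \in gs -> noetherian (representable C (tag g))) -> noetherian V.
Proof.
move=> gen_gs noeth; have [e eP] := free_cover gen_gs.
apply: (noetherian_quotient (f := e)) => [s v|]; first exact/eP.
by apply: noetherian_free => _ /mapP[g /noeth + ->].
Qed.

(** * Resolutions by free modules *)

Lemma kernel_cover W U (f : cmod_hom W U) :
  noetherian W ->
  exists p : {ds : seq nat & cmod_hom (free ds) W}, exact_at (tagged p) f.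
Proof.
case/(_ (ker_sub f))/fg_submoduleP=> gs /free_cover[d dP].
by exists (existT (fun ds => cmod_hom (free ds) W) _ d) => s v; exact: dP.
Qed.

(** A differential whose source is free.  Bundling source and target with the
    map lets the next differential have the source of the previous one as its
    target by definition, so that a resolution is obtained by plain iteration. *)
Record free_map := FreeMap {
  fm_degs : seq nat;
  fm_tgt : cmod C;
  fm_map : cmod_hom (free fm_degs) fm_tgt }.

Lemma finitely_presented_of_noetherian V :
  (forall W, finitely_generated W -> noetherian W) ->
  finitely_generated V -> finitely_presented V.
Proof.
move=> noeth /fg_submoduleP[gs /free_cover[e eP]].
have cover (x : free_map) := cid (kernel_cover (fm_map x) (noeth _ (fg_free _))).
pose next x := FreeMap (tagged (sval (cover x))).
pose res := fix res n := if n is m.+1 then next (res m) else FreeMap e.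
pose d n : cmod_hom (free (fm_degs (res n.+1))) (free (fm_degs (res n))) :=
  fm_map (res n.+1).
exists (fun n => free (fm_degs (res n))), d, e.
split; [split=> [n|s v||n] | exact: fg_free | exact: fg_free].
- exact: projective_free.
- exact/eP.
- exact: svalP (cover (res 0)).
- exact: svalP (cover (res n.+1)).
Qed.

(** * Degreewise finite generation and quotients *)

Lemma fg_kmodule_sub (k_noetherian : noetherian_ring k) V (N : submodule V) r :
  fg_kmodule (V r) ->
  exists hs : seq (V r),
    (forall h, h \in hs -> N r h) /\ (forall x, N r x -> kspan hs x).
Proof.
case/fg_ksubmodule_kspan=> gs [_ span_gs].
by apply: noetherian_ring_ksub (subm_ksub N r) _ => // x _; exact: span_gs.
Qed.

Lemma gen_in_degrees_generators (s : nat) V :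
  (forall r, exists gs : seq (V r), forall x, kspan gs x) ->
  gen_in_degrees (s%:Z - 1) V ->
  exists2 gs, generates (full_submodule V) gs &
    forall g, g \in gs -> (tag g < s)%N.
Proof.
move=> fgV gen_s.
have [gs gs_lt gsP] : exists2 gs : seq {r & V r},
    forall g, g \in gs -> (tag g < s)%N &
    forall N : submodule V, (forall g, g \in gs -> N (tag g) (tagged g)) ->
      forall r, (r < s)%N -> forall v : V r, N r v.
  elim: s {gen_s} => [|s [gs gs_lt gsP]]; first by exists [::].
  have [hs span_hs] := fgV s.
  exists (map (@elt V s) hs ++ gs) => [g|N Ngs r].
    by rewrite mem_cat => /orP[/mapP[h _ ->]//|/gs_lt/ltnW].
  rewrite ltnS leq_eqVlt => /predU1P[-> v|]; last first.
    by apply: gsP => g ggs; apply: Ngs; rewrite mem_cat ggs orbT.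
  apply: kspan_min (span_hs v) => [|h hhs]; first exact: subm_ksub.
  by apply: (Ngs (elt h)); rewrite mem_cat map_f.
exists gs => //; split=> // N Ngs r v _; apply: gen_s => t.
by rewrite lerBrDr -PoszD addn1 lez_nat; exact: gsP.
Qed.

Definition mquot_proj V (N : submodule V) : cmod_hom V (mquot N).
Proof.
refine (@mk_hom V (mquot N) (fun s => kquot_pi (subm_ksub N s)) _ _).
- by move=> s a u v; rewrite linearP.
- by move=> r s g v; rewrite [RHS]mquot_act_funE.
Defined.

Lemma mquot_proj_surjective V (N : submodule V) : hom_surjective (mquot_proj N).
Proof. by move=> s w; exists (repr w); exact: kquot_piK. Qed.

Lemma mquot_proj_eq V (N : submodule V) s (v w : V s) :
  mquot_proj N s v = mquot_proj N s w <-> N s (v - w).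
Proof. exact: kquot_piP. Qed.

Lemma mquot_proj_eq0 V (N : submodule V) s (v : V s) :
  mquot_proj N s v = 0 <-> N s v.
Proof. by rewrite -(linear0 (mquot_proj N s)) mquot_proj_eq subr0. Qed.

End Submodules.

(** * The shift functor *)

Section ShiftFunctor.
Variables (k : comPzRingType) (k_noetherian : noetherian_ring k).
Variables (C : kcat k) (iota : self_embedding C).
Implicit Types V : cmod C.

Definition shift_sub V (X : submodule V) : submodule (shift iota V).
Proof.
exists (fun s => X s.+1) => [s|r s f v Xv]; first exact: (subm_ksub X s.+1).
exact: subm_act.
Defined.

(** Elements of the shift of [X] are elements of [X] of positive degree, and the
    structure maps of the shift are among those of [X].  Only the component of
    degree [0] is not seen by the shift; as [k] is Noetherian, it contributes
    finitely many further elements. *)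
Lemma unshift_generators V (X : submodule V) (gs : seq {s & shift iota V s}) :
  fg_kmodule (V 0%N) ->
  (forall g, g \in gs -> shift_sub X (tag g) (tagged g)) ->
  exists hs : seq {s & V s}, (forall h, h \in hs -> X (tag h) (tagged h)) /\
    forall N : submodule V, (forall h, h \in hs -> N (tag h) (tagged h)) ->
      (forall g, g \in gs -> shift_sub N (tag g) (tagged g)) /\
      (forall v : V 0%N, X 0%N v -> N 0%N v).
Proof.
move=> fgV0 Xgs; have [hs [Xhs span_hs]] := fg_kmodule_sub k_noetherian X fgV0.
exists ([seq @elt _ _ V (tag g).+1 (tagged g) | g <- gs] ++
        [seq @elt _ _ V 0%N h | h <- hs]).
split=> [h|N Nhs].
  by rewrite mem_cat => /orP[] /mapP[g ggs ->]; [exact: Xgs | exact: Xhs].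
split=> [g ggs|v Xv].
  apply: (Nhs (@elt _ _ V (tag g).+1 (tagged g))); rewrite mem_cat.
  by apply/orP; left; exact: map_f.
apply: kspan_min (span_hs v Xv) => [|h hhs]; first exact: subm_ksub.
apply: (Nhs (elt h)); rewrite mem_cat.
by apply/orP; right; exact: (map_f (@elt _ _ V 0%N)).
Qed.

Lemma fg_unshift V (X : submodule V) :
  fg_kmodule (V 0%N) -> fg_submodule (shift_sub X) -> fg_submodule X.
Proof.
move=> fgV0 /fg_submoduleP[gs [Xgs genX]].
have [hs [Xhs hsP]] := unshift_generators fgV0 Xgs.
apply/fg_submoduleP; exists hs; split=> // N /hsP[Ngs N0] [|s] v.
  exact: N0.
exact: (genX (shift_sub N) Ngs).
Qed.

Variable mu : forall V : cmod C, cmod_hom V (shift iota V).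
Hypothesis mu_natural : natural_to_shift mu.

(** Naturality along the Yoneda map of [v] turns [mu] into the action of a
    morphism of the category, so that submodules are stable under it. *)
Lemma mu_act V s (v : V s) :
  mu V s v = cact V (mu (representable C s) s (cidm C s) : C s s.+1) v.
Proof.
have := mu_natural (yoneda v) (cidm C s).
by rewrite /= cact_id.
Qed.

Lemma sub_mu V (X : submodule V) s (v : V s) : X s v -> X s.+1 (mu V s v).
Proof. by rewrite mu_act; exact: subm_act. Qed.

(** Modulo [X], this is the kernel of [mu] on the quotient module [V / X]. *)
Definition desat V (X : submodule V) : submodule V :=
  preim_sub (mu V) (shift_sub X).

Section NoetherianCokernel.
Variables (V : cmod C) (fgV0 : fg_kmodule (V 0%N)).
Hypothesis noeth_coker : noetherian (coker (mu V)).
Implicit Types X : submodule V.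

Let pr := mquot_proj (image_submodule (mu V)).

(** The shift of [X] is an extension of a submodule of the cokernel of [mu] by
    the image under [mu] of [desat X]. *)
Lemma fg_shift_desat X : fg_submodule (desat X) -> fg_submodule (shift_sub X).
Proof.
move=> fgX; apply: (fg_extension (f := pr)); first exact: noeth_coker.
apply: eqsub_fg (fg_img (mu V) fgX) => s v; split=> [[u Xu <-]|[Xv kv]].
  split; first exact: Xu.
  by apply/mquot_proj_eq0; exists u.
by move/mquot_proj_eq0: kv => -[u _ uv]; exists u; rewrite //= uv.
Qed.

(** An element of [X] of positive degree is corrected, by elements generated
    from lifts of generators of the image of the shift of [X] in the cokernel,
    to some [mu u]; then [u] lies in [desat X = X] and has smaller degree. *)
Lemma fg_saturated X :
  (forall s (v : V s), desat X s v -> X s v) -> fg_submodule X.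
Proof.
move=> satX.
have [gs [Xgs gsP]] := fg_img_lift (noeth_coker (img_sub pr (shift_sub X))).
have [hs [Xhs hsP]] := unshift_generators fgV0 Xgs.
apply/fg_submoduleP; exists hs; split=> // N /hsP[Ngs N0].
elim=> [|s IH] v Xv; first exact: N0.
have [y [Xy Ny /mquot_proj_eq[u _ uE]]] := gsP (shift_sub N) Ngs s v Xv.
rewrite -[v](subrK y); apply: (ksub_add (subm_ksub N s.+1)) => //.
rewrite -uE; apply: sub_mu; apply: IH; apply: satX; rewrite /= uE.
exact: (ksub_sub (subm_ksub X s.+1)).
Qed.

Definition desat_iter X n : submodule V := iter n (@desat V) X.

Lemma desat_iter_mono X m n s (v : V s) :
  (m <= n)%N -> desat_iter X m s v -> desat_iter X n s v.
Proof.
move/subnK<-; elim: (n - m)%N => // i IH /IH.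
exact: sub_mu.
Qed.

Definition saturation X : submodule V.
Proof.
exists (fun s v => exists n, desat_iter X n s v) => [s|r s f v [n Xv]].
  split=> [|a u v [m Xu] [n Xv]].
    by exists 0%N; exact: (subm_ksub (desat_iter X 0) s).1.
  exists (maxn m n); apply: (subm_ksub (desat_iter X _) s).2.
    exact: desat_iter_mono (leq_maxl _ _) Xu.
  exact: desat_iter_mono (leq_maxr _ _) Xv.
by exists n; exact: subm_act.
Defined.

Lemma fg_desat_iter X : exists n, fg_submodule (desat_iter X n).
Proof.
have /fg_submoduleP[gs [Xgs genX]] : fg_submodule (saturation X).
  by apply: fg_saturated => s v [n Xv]; exists n.+1.
have [n Xn] : exists n, forall g, g \in gs -> desat_iter X n (tag g) (tagged g).
  elim: gs Xgs {genX} => [|g gs IH] Xgs; first by exists 0%N.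
  have [m Xm] := IH (fun h => Xgs h \o @mem_behead _ (g :: gs) h).
  have [n Xn] := Xgs g (mem_head g gs).
  exists (maxn m n) => h; rewrite inE => /predU1P[->|/Xm Xh].
    exact: desat_iter_mono (leq_maxr _ _) Xn.
  exact: desat_iter_mono (leq_maxl _ _) Xh.
exists n; apply/fg_submoduleP; exists gs; split=> // N Ngs s v Xv.
by apply: genX => //; exists n.
Qed.

(** Along the chain of iterates of [desat], finite generation of one member
    passes to the previous one. *)
Lemma noetherian_of_coker : noetherian V.
Proof.
move=> X; have [n] := fg_desat_iter X.
elim: n => // n IH fgXn; apply: IH; apply: fg_unshift => //.
exact: fg_shift_desat.
Qed.

Lemma fg_shift : finitely_generated V -> finitely_generated (shift iota V).
Proof.
move=> fgV; apply: (eqsub_fg (N := shift_sub (full_submodule V))) => //.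
by apply: fg_shift_desat; apply: eqsub_fg fgV.
Qed.

End NoetherianCokernel.

Hypothesis C_locally_finite : locally_finite C.
Hypothesis coker_gen : forall s : nat,
  gen_in_degrees (s%:Z - 1) (coker (mu (representable C s))).

(** The components of the cokernel are quotients of hom modules of [C], so
    generation in degrees less than [s] yields finitely many generators, which
    involve only the representables [M(r)] with [r < s]. *)
Lemma noetherian_coker_representable s :
  (forall r, (r < s)%N -> noetherian (representable C r)) ->
  noetherian (coker (mu (representable C s))).
Proof.
move=> noeth.
have [r|gs gen_gs gs_lt] := gen_in_degrees_generators _ (@coker_gen s).
  have [gs [_ span_gs]] := fg_ksubmodule_kspan (@C_locally_finite s r.+1).
  exists (map (mquot_proj (image_submodule (mu (representable C s))) r) gs) => w.
  have [v <-] := mquot_proj_surjective w.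
  by apply: kspan_map; exact: span_gs.
by apply: noetherian_of_generators gen_gs _ => g /gs_lt; exact: noeth.
Qed.

Lemma noetherian_representable s : noetherian (representable C s).
Proof.
elim/ltn_ind: s => s IH; apply: noetherian_of_coker.
  exact: C_locally_finite.
exact: noetherian_coker_representable.
Qed.

Lemma fg_shift_representable s :
  finitely_generated (shift iota (representable C s)).
Proof.
apply: fg_shift; last exact: fg_representable.
by apply: noetherian_coker_representable => r _; exact: noetherian_representable.
Qed.

End ShiftFunctor.

Theorem theorem1p5 (k : comPzRingType) (k_noetherian : noetherian_ring k)
    (C : kcat k) (C_locally_finite : locally_finite C) (C_directed : directed C)
    (iota : self_embedding C) (S_generic : generic_shift iota) :
  (forall V : cmod C, finitely_generated V -> noetherian V) <->
  (forall s : nat, finitely_presented (shift iota (representable C s))).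
Proof.
have [mu [mu_natural mu_generic]] := S_generic.
have coker_gen s := (mu_generic s).2.
split=> [noeth s|_ V /fg_submoduleP[gs gen_gs]].
  apply: finitely_presented_of_noetherian => //.
  exact: (fg_shift_representable k_noetherian mu_natural).
apply: noetherian_of_generators gen_gs _ => g _.
exact: (noetherian_representable k_noetherian mu_natural).
Qed.
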